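(* Let $F$ be an algebraically closed field and let $I \subseteq J$ be index sets such that $I$ is non-empty and $|I| < |F|$ (no restriction is imposed on the cardinality of $J$). Let $\mathfrak{u}$ be an ideal of $F[t_j \mid j \in J]$ of the form $\mathfrak{u} = \mathfrak{a}\, F[t_j \mid j \in J]$ for some ideal $\mathfrak{a}$ of $F[t_i \mid i \in I]$. Then \[ \mathbb{I}(\mathbb{V}(\mathfrak{u})) = \sqrt{\mathfrak{u}}. \]
   Context: $F[t_i \mid i \in I] \subseteq F[t_j \mid j \in J]$ are the polynomial algebras over $F$ in the indicated (possibly infinitely many) variables, and $\mathfrak{a}\, F[t_j \mid j \in J]$ is the ideal of $F[t_j \mid j \in J]$ generated by $\mathfrak{a}$. The zero set is taken in $F^J$: $\mathbb{V}(\mathfrak{u}) = \{x \in F^J \mid f(x) = 0 \text{ for all } f \in \mathfrak{u}\}$. For $X \subseteq F^J$, the vanishing ideal is $\mathbb{I}(X) = \{f \in F[t_j \mid j \in J] \mid f(x) = 0 \text{ for all } x \in X\}$ (so $\mathbb{I}(\emptyset)$ is the whole ring). $\sqrt{\mathfrak{u}}$ is the radical of $\mathfrak{u}$ in $F[t_j \mid j \in J]$. $|S|$ denotes the cardinality of a set $S$. *)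

(* Defs.v *)
From HB Require Import structures.
From mathcomp Require Import all_boot all_order all_algebra.
From mathcomp Require Import finmap.
From mathcomp Require Import boolp classical_sets functions cardinality.
From mathcomp Require Import monalg.

Set Implicit Arguments.
Unset Strict Implicit.
Unset Printing Implicit Defensive.

Import GRing.Theory.
Local Open Scope classical_set_scope.
Local Open Scope ring_scope.

(* The commutative polynomial algebra F[t_j | j in J], realized as the monoid
   algebra of the finitely supported exponent functions J -> nat.  Classically
   every type carries a choiceType structure, so J is an arbitrary index set. *)
Notation mvpoly F J := {malg F[{cmonom J}]}.

Definition mvar (F : fieldType) (J : choiceType) (j : J) : mvpoly F J :=
  << 1 *g ucm j >>.

Definition mvconst (F : fieldType) (J : choiceType) (c : F) : mvpoly F J :=
  << c *g mone >>.

(* Replaces every coefficient c by phi c and every variable t_j by v j. *)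
Definition mvsubst (F : fieldType) (J : choiceType) (S : comNzRingType)
    (phi : F -> S) (v : J -> S) (f : mvpoly F J) : S :=
  mmap phi (fun m : {cmonom J} => \prod_(j <- finsupp m) v j ^+ m j) f.

Definition mveval (F : fieldType) (J : choiceType) (x : J -> F)
    (f : mvpoly F J) : F :=
  mvsubst idfun x f.

(* The inclusion F[t_i | i in I] -> F[t_j | j in J] for I a subset of J. *)
Definition mvincl (F : fieldType) (J : choiceType) (I : set J)
    (f : mvpoly F (set_type I)) : mvpoly F J :=
  mvsubst (@mvconst F J) (fun i : set_type I => mvar F (val i)) f.

(* Unlike the library's idealr, an ideal need neither be proper nor be
   decidable. *)
Definition is_ideal (R : comNzRingType) (a : set R) : Prop :=
  [/\ a 0,
      forall f g : R, a f -> a g -> a (f + g)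
    & forall h f : R, a f -> a (h * f)].

Definition ideal_gen (R : comNzRingType) (A : set R) : set R :=
  smallest (@is_ideal R) A.

Definition radical (R : comNzRingType) (a : set R) : set R :=
  [set f | exists2 n : nat, (0 < n)%N & a (f ^+ n)].

Definition ideal_ext (F : fieldType) (J : choiceType) (I : set J)
    (a : set (mvpoly F (set_type I))) : set (mvpoly F J) :=
  ideal_gen (@mvincl F J I @` a).

Definition zero_set (F : fieldType) (J : choiceType)
    (u : set (mvpoly F J)) : set (J -> F) :=
  [set x | forall f, u f -> mveval x f = 0].

Definition vanishing_ideal (F : fieldType) (J : choiceType)
    (X : set (J -> F)) : set (mvpoly F J) :=
  [set f | forall x, X x -> mveval x f = 0].

Definition card_lt (T U : Type) (A : set T) (B : set U) : Prop :=
  card_le A B /\ ~ card_eq A B.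

(* Main.v *)
Require Import Defs.
From HB Require Import structures.
From mathcomp Require Import all_boot all_order all_algebra.
From mathcomp Require Import finmap ring.
From mathcomp Require Import boolp classical_sets functions cardinality.
From mathcomp Require Import monalg.

Set Implicit Arguments.
Unset Strict Implicit.
Unset Printing Implicit Defensive.

Import GRing.Theory.
Local Open Scope classical_set_scope.
Local Open Scope ring_scope.

(** If f vanishes on the zeros of u but no power of f lies in u, a point of
    F^J killing u but not f gives a contradiction.  Only the variables of I
    and the finitely many variables occurring in f matter; let K be the set of
    these.  In F[t_k | k in K], Zorn's lemma yields an ideal q that contains
    the trace of u and is maximal among those avoiding the powers of f
    ([prime_avoiding]); it is prime, and it suffices to find a point of F^K
    where all of q vanishes and f does not.  Extended by 0, that point is a
    zero of u, because u is generated by polynomials in the variables of I.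

    When I is finite, so is K, and the point comes from an extension argument
    along polynomial rings: if every element outside a prime ideal of a domain
    R can be kept nonzero by a morphism to F that kills the prime, then the
    same holds for R[X] ([separates_poly]).  Modulo the prime, X is either
    transcendental, and is then sent to a non-root of one polynomial, or a root
    of a polynomial p of minimal degree, and is then sent to a root of the
    image of p; pseudo-division by p shows that this choice kills the prime.
    This covers countable fields, for which counting says nothing.

    When I is infinite, counting suffices.  There are only |K| = |I| monomials
    and as many finite sets of monomials, by |A x A| = |A| for infinite A
    ([embeds_square]).  If some variable t were congruent to no constant modulo
    q, then by maximality t - c would divide a power of f modulo q for every c
    in F.  As |I| < |F|, infinitely many of these partial inverses have the
    same support and go with the same power of f, so they are linearly
    dependent; clearing denominators turns the dependence into a nonzero
    polynomial of F[X] sending t into q, and since F is algebraically closed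
    and q is prime, some t - c lies in q after all ([resolvent_relation]).
    Hence every variable is congruent to a constant modulo q, and these
    constants are the coordinates of the point. *)

(** * Cardinals of infinite types *)

Definition embeds (T U : Type) : Prop := exists f : T -> U, injective f.

Lemma embeds_trans T U V : embeds T U -> embeds U V -> embeds T V.
Proof.
by move=> [f f_inj] [g g_inj]; exists (g \o f); apply: inj_comp.
Qed.

(** Comparability of cardinals: a maximal partial injection between T and U
    must be total on one of the two sides. *)
Lemma embeds_total T U : embeds T U \/ embeds U T.
Proof.
pose part (G : set (T * U)) :=
  (forall x y y', G (x, y) -> G (x, y') -> y = y') /\
  (forall x x' y, G (x, y) -> G (x', y) -> x = x').
have part_chain (C : set (set (T * U))) : C `<=` part -> total_on C subset ->
    part (\bigcup_(G in C) G).
  move=> Cpart Ctot; split=> [x y y'|x x' y] [G CG Gxy] [G' CG' Gxy'];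
    case: (Ctot _ _ CG CG') => sub.
  - by apply: (Cpart _ CG').1 Gxy'; apply: sub.
  - by apply: (Cpart _ CG).1 Gxy _; apply: sub.
  - by apply: (Cpart _ CG').2 Gxy'; apply: sub.
  - by apply: (Cpart _ CG).2 Gxy _; apply: sub.
have [G [[Gfun Ginj] Gmax]] := Zorn_bigcup part_chain.
have [Gl|/existsNP[x0 Gx0]] := pselect (forall x, exists y, G (x, y)).
  have [f Gf] := choice Gl; left; exists f => x x' ff.
  by apply: Ginj (Gf x) _; rewrite ff.
have [Gr|/existsNP[y0 Gy0]] := pselect (forall y, exists x, G (x, y)).
  have [f Gf] := choice Gr; right; exists f => x x' ff.
  by apply: Gfun (Gf x) _; rewrite ff.
exfalso; apply: (Gmax (G `|` [set (x0, y0)])).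
  split; first by move=> z; left.
  by move/(_ (x0, y0) (or_intror erefl)) => Gxy; apply: Gx0; exists y0.
split=> [x y y'|x x' y] [Gxy|[ex ey]] [Gxy'|[ex' ey']]; subst => //.
- exact: Gfun Gxy Gxy'.
- by case: Gx0; exists y.
- by case: Gx0; exists y'.
- exact: Ginj Gxy Gxy'.
- by case: Gy0; exists x.
- by case: Gy0; exists x'.
Qed.

Section Squaring.
Variable A : Type.

(** A set G of triples is viewed as the graph of a partial operation; its
    domain is the square of [field_of G], the elements that G pairs with
    themselves. *)
Definition field_of (G : set (A * A * A)) : set A :=
  [set x | exists z, G (x, x, z)].

(** G is the graph of an injection from B x B to B, for B = [field_of G]. *)
Definition pairing (G : set (A * A * A)) : Prop :=
  [/\ forall x y, field_of G x -> field_of G y ->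
        exists2 z, field_of G z & G (x, y, z),
      forall x y z, G (x, y, z) -> field_of G x /\ field_of G y,
      forall x y z z', G (x, y, z) -> G (x, y, z') -> z = z'
    & forall x y x' y' z, G (x, y, z) -> G (x', y', z) -> x = x' /\ y = y'].

Lemma field_of_sub G H : G `<=` H -> field_of G `<=` field_of H.
Proof. by move=> sub x [z Gz]; exists z; apply: sub. Qed.

Lemma pairing_chain (C : set (set (A * A * A))) :
  C `<=` pairing -> total_on C subset -> pairing (\bigcup_(G in C) G).
Proof.
move=> Cpair Ctot.
have join G G' : C G -> C G' -> exists H, [/\ C H, G `<=` H & G' `<=` H].
  by move=> CG CG'; case: (Ctot _ _ CG CG') => sub; [exists G'|exists G]; split.
have fieldU G : C G -> field_of G `<=` field_of (\bigcup_(G in C) G).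
  by move=> CG; apply: field_of_sub; apply: bigcup_sup.
split.
- move=> x y [z [G CG Gz]] [z' [G' CG' Gz']].
  have [H [CH sGH sGH']] := join _ _ CG CG'; have [tot _ _ _] := Cpair _ CH.
  have [||w Hw Hxyw] := tot x y; first by exists z; apply: sGH.
    by exists z'; apply: sGH'.
  by exists w; [apply: fieldU Hw|exists H].
- move=> x y z [G CG Gxyz]; have [_ fld _ _] := Cpair _ CG.
  by have [Gx Gy] := fld _ _ _ Gxyz; split; apply: (fieldU G).
- move=> x y z z' [G CG Gz] [G' CG' Gz'].
  have [H [CH sGH sGH']] := join _ _ CG CG'; have [_ _ func _] := Cpair _ CH.
  by apply: func (sGH _ Gz) (sGH' _ Gz').
- move=> x y x' y' z [G CG Gz] [G' CG' Gz'].
  have [H [CH sGH sGH']] := join _ _ CG CG'; have [_ _ _ inj] := Cpair _ CH.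
  by apply: inj (sGH _ Gz) (sGH' _ Gz').
Qed.

Lemma pairing_fun G : pairing G -> exists p : A -> A -> A,
  [/\ forall x y, field_of G x -> field_of G y -> G (x, y, p x y),
      forall x y, field_of G x -> field_of G y -> field_of G (p x y)
    & forall x y x' y', field_of G x -> field_of G y ->
        field_of G x' -> field_of G y' -> p x y = p x' y' -> x = x' /\ y = y'].
Proof.
move=> [tot fld func inj].
have /choice[p pP] (xy : A * A) : exists z,
    field_of G xy.1 -> field_of G xy.2 -> field_of G z /\ G (xy, z).
  case: xy => x y /=.
  have [Gx|nGx] := pselect (field_of G x); last by exists x.
  have [Gy|nGy] := pselect (field_of G y); last by exists x.
  by have [z] := tot x y Gx Gy; exists z.
exists (fun x y => p (x, y)); split=> [x y Gx Gy|x y Gx Gy|].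
- by have [] := pP (x, y) Gx Gy.
- by have [] := pP (x, y) Gx Gy.
- move=> x y x' y' Gx Gy Gx' Gy' e.
  have [_ Gxy] := pP (x, y) Gx Gy; have [_ Gxy'] := pP (x', y') Gx' Gy'.
  by apply: inj Gxy _; rewrite e.
Qed.

(** The Cantor pairing carried by a copy of nat in A lies below the maximal
    one, so that the latter lives on a set with two distinct elements. *)
Lemma maximal_pairing : embeds nat A -> exists G, [/\ pairing G,
  exists b0 b1, [/\ field_of G b0, field_of G b1 & b0 <> b1]
  & forall H, G `<` H -> ~ pairing H].
Proof.
move=> [e e_inj].
pose code (n m : nat) := e (choice.pickle (n, m)).
pose G0 : set (A * A * A) :=
  [set t | exists n m, t = (e n, e m, code n m)].
have field0 x : field_of G0 x <-> exists n, x = e n.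
  split=> [[z [n [m [-> _ _]]]]|[n ->]]; first by exists n.
  by exists (code n n), n, n.
have code_inj n m n' m' : code n m = code n' m' -> n = n' /\ m = m'.
  by move=> /e_inj/(pcan_inj choice.pickleK)[-> ->].
have G0pair : pairing G0.
  split.
  - move=> _ _ /field0[n ->] /field0[m ->].
    by exists (code n m); [apply/field0; eexists|exists n, m].
  - by move=> x y z [n [m [-> -> _]]]; split; apply/field0; eexists.
  - by move=> x y z z' [n [m [-> -> ->]]] [n' [m' [/e_inj-> /e_inj-> ->]]].
  - move=> x y x' y' z [n [m [-> -> ->]]] [n' [m' [-> ->]]].
    by move=> /code_inj[-> ->].
(* The empty graph is admitted so that the empty chain has an upper bound. *)
pose P G := G = set0 \/ (G0 `<=` G /\ pairing G).
have [C CP Ctot|G [PG Gmax]] := @Zorn_bigcup _ P.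
  pose C' := [set G | C G /\ G !=set0].
  have CC' : \bigcup_(G in C) G = \bigcup_(G in C') G.
    apply/seteqP; split=> [t [G CG Gt]|t [G [CG _] Gt]]; exists G => //.
    by split=> //; exists t.
  have C'P G : C' G -> G0 `<=` G /\ pairing G.
    by move=> [/CP [->|//] [t]].
  have [[G C'G]|C'0] := pselect (exists G, C' G); last first.
    left; rewrite CC'; apply/seteqP; split=> // t [G C'G _].
    by case: C'0; exists G.
  right; rewrite CC'; split.
    by move=> t G0t; exists G => //; apply: (C'P _ C'G).1.
  apply: pairing_chain => [H /C'P[]//|H H' [CH _] [CH' _]].
  exact: Ctot.
have [sub0 Gpair] : G0 `<=` G /\ pairing G.
  case: PG => [G_eq0|//]; case: (Gmax G0); last by right; split.
  split; first by rewrite G_eq0; apply: sub0set.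
  by rewrite G_eq0 => /(_ (e 0, e 0, code 0 0)%N); apply; exists 0%N, 0%N.
exists G; split=> //.
  exists (e 0%N), (e 1%N); split; last by move/e_inj.
    by apply: (field_of_sub sub0); apply/field0; eexists.
  by apply: (field_of_sub sub0); apply/field0; eexists.
move=> H GH Hpair; apply: (Gmax H GH); right; split=> //.
by apply: subset_trans sub0 _; case: GH.
Qed.

(** If the complement of B contains a disjoint copy h(B), then the pairing
    extends to B + h(B): this union embeds into B, with b0 and b1 as tags for
    the two summands, and so its new pairs can be coded in h(B). *)
Lemma pairing_extend G (h : A -> A) b0 b1 : pairing G ->
    field_of G b0 -> field_of G b1 -> b0 <> b1 ->
    (forall x, field_of G x -> ~ field_of G (h x)) ->
    (forall x y, field_of G x -> field_of G y -> h x = h y -> x = y) ->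
  exists2 H, G `<` H & pairing H.
Proof.
move=> Gpair Bb0 Bb1 b01; have [p [pG pB p_inj]] := pairing_fun Gpair.
have [_ fld func _] := Gpair.
pose B := field_of G => hB h_inj.
pose D x := B x \/ exists2 y, B y & x = h y.
have /choice[k kP] (x : A) : exists y, D x -> ~ B x -> B y /\ h y = x.
  have [[y By xh]|nx] := pselect (exists2 y, B y & x = h y).
    by exists y => _ _.
  by exists x => -[//|/nx].
pose u x := if pselect (B x) then p b0 x else p b1 (k x).
have uB x : D x -> B (u x).
  by rewrite /u => Dx; case: pselect => Bx; apply: pB => //; case: (kP x).
have u_inj x y : D x -> D y -> u x = u y -> x = y.
  rewrite /u => Dx Dy; case: pselect => Bx; case: pselect => By.
  - by move=> /p_inj[].
  - by have [Bk _] := kP y Dy By; move=> /p_inj[].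
  - by have [Bk _] := kP x Dx Bx; move=> /esym/p_inj[].
  - have [Bkx hx] := kP x Dx Bx; have [Bky hy] := kP y Dy By.
    by move=> /p_inj[//|//|//|//|_ e]; rewrite -hx -hy e.
pose q x y := if pselect (B x /\ B y) then p x y else h (p (u x) (u y)).
pose H : set (A * A * A) :=
  [set t | [/\ D t.1.1, D t.1.2 & t.2 = q t.1.1 t.1.2]].
have BD x : B x -> D x by left.
have qD x y : D x -> D y -> D (q x y).
  move=> Dx Dy; rewrite /q; case: pselect => [[Bx By]|nB]; first exact/BD/pB.
  by right; exists (p (u x) (u y)) => //; apply: pB; apply: uB.
have HD x : field_of H x <-> D x.
  split=> [[z [Dx _ _]] //|Dx]; exists (q x x); split => //.
exists H.
  split=> [[[x y] z] Gxyz|].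
    have [Bx By] := fld _ _ _ Gxyz; split=> /=; [exact: BD|exact: BD|].
    rewrite /q; case: pselect => [BB|[]//].
    by apply: func Gxyz _; apply: pG.
  have Hhb0 : field_of H (h b0) by apply/HD; right; exists b0.
  by move=> /field_of_sub /(_ _ Hhb0); apply: hB.
split.
- move=> x y /HD Dx /HD Dy; exists (q x y); first exact/HD/qD.
  by split.
- by move=> x y z [/= Dx Dy _]; split; apply/HD.
- by move=> x y z z' [/= _ _ ->] [/= _ _ ->].
move=> x y x' y' z [/= Dx Dy ->] [/= Dx' Dy'].
rewrite /q; case: pselect => [[Bx By]|nB]; case: pselect => [[Bx' By']|nB'] /=.
- by move=> /p_inj[].
- move=> e; case: (hB (p (u x') (u y'))); first by apply: pB; apply: uB.
  by rewrite -e; apply: pB.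
- move=> e; case: (hB (p (u x) (u y))); first by apply: pB; apply: uB.
  by rewrite e; apply: pB.
- move=> /h_inj e.
  have /p_inj : p (u x) (u y) = p (u x') (u y').
    by apply: e; apply: pB; apply: uB.
  by case; [exact: uB|exact: uB|exact: uB|exact: uB|split; apply: u_inj].
Qed.

(** Take a maximal pairing, on B say.  The complement of B cannot contain a copy
    of B, by [pairing_extend]; hence it embeds into B, so A embeds into B + B,
    hence into B, and the pairing of B serves for A. *)
Lemma embeds_square : embeds nat A -> embeds (A * A) A.
Proof.
move=> /maximal_pairing[G [Gpair [b0 [b1 [Bb0 Bb1 b01]]] Gmax]].
have [[f f_inj]|[h h_inj]] :=
  embeds_total {x | ~ field_of G x} {x | field_of G x}; last first.
  pose h' x := if pselect (field_of G x) is left Bx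
               then sval (h (exist _ x Bx)) else x.
  have [|x y|H GH /(Gmax _ GH)//] :=
    @pairing_extend G h' b0 b1 Gpair Bb0 Bb1 b01.
    by rewrite /h' => x Bx; case: pselect => [{}Bx|//]; case: (h _).
  rewrite /h'; case: pselect => [Bx _|//]; case: pselect => [By _|//].
  by move=> e; have /h_inj[] : h (exist _ x Bx) = h (exist _ y By)
    by apply: eq_sig_hprop e => z p q; apply: Prop_irrelevance.
have [p [_ pB p_inj]] := pairing_fun Gpair.
pose u x := if pselect (field_of G x) is right nBx
            then p b1 (sval (f (exist _ x nBx))) else p b0 x.
have uB x : field_of G (u x).
  by rewrite /u; case: pselect => Bx; apply: pB => //; case: (f _).
have u_inj : injective u.
  move=> x y; rewrite /u; case: pselect => Bx; case: pselect => By.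
  - by move=> /p_inj[].
  - by move=> /p_inj[//|//|//||/b01//]; case: (f _).
  - by move=> /esym/p_inj[//|//|//||/b01//]; case: (f _).
  - move=> /p_inj[//||//||_]; try by case: (f _).
    move=> e; have /f_inj[] // : f (exist _ x Bx) = f (exist _ y By).
    by apply: eq_sig_hprop e => z p' q; apply: Prop_irrelevance.
exists (fun xy => p (u xy.1) (u xy.2)) => -[x y] [x' y'] /=.
by move=> /p_inj[//|//|//|//|/u_inj-> /u_inj->].
Qed.

End Squaring.

Lemma embeds_seq A : embeds nat A -> embeds (seq A) A.
Proof.
move=> nA; have [[e e_inj] [p p_inj]] := (nA, embeds_square nA).
pose code := foldr (fun x c => p (x, c)) (e 0%N).
exists (fun s => p (e (size s), code s)) => s t /p_inj[/e_inj].
elim: s t => [|x s IHs] [|y t] //= [/IHs eq_st] /p_inj[-> /eq_st->].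
by [].
Qed.

Lemma embeds_sum_nat A : embeds nat A -> embeds (A + nat) A.
Proof.
move=> nA; have [e e_inj] := nA.
apply: embeds_trans (embeds_square nA).
exists (fun z => match z with inl a => (e 0%N, a) | inr n => (e 1%N, e n) end).
by move=> [a|n] [b|m] // [] => [->|/e_inj//|/e_inj//|/e_inj->].
Qed.

Lemma embeds_prod T U A :
  embeds nat A -> embeds T A -> embeds U A -> embeds (T * U) A.
Proof.
move=> nA [f f_inj] [g g_inj]; apply: embeds_trans (embeds_square nA).
by exists (fun z => (f z.1, g z.2)) => -[x y] [x' y'] [/f_inj-> /g_inj->].
Qed.

Lemma embeds_fset (T : choiceType) A :
  embeds nat A -> embeds T A -> embeds {fset T} A.
Proof.
move=> nA [f f_inj]; apply: embeds_trans (embeds_seq nA).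
exists (fun s : {fset T} => map f (enum_fset s)) => s t /(inj_map f_inj) e.
by apply/fsetP => x; rewrite -[x \in s]/(x \in enum_fset s) e.
Qed.

Lemma embeds_cmonom (K : choiceType) A :
  embeds nat A -> embeds K A -> embeds {cmonom K} A.
Proof.
move=> nA KA; have [f f_inj] := embeds_prod nA KA nA.
apply: embeds_trans (embeds_seq nA).
pose graph (m : {cmonom K}) := [seq (i, m i) | i <- enum_fset (finsupp m)].
exists (map f \o graph) => m m' /(inj_map f_inj) mm'.
have e1 : enum_fset (finsupp m) = enum_fset (finsupp m').
  by have := congr1 unzip1 mm'; rewrite /graph /unzip1 -!map_comp !map_id.
have e2 : {in enum_fset (finsupp m), forall i, m i = m' i}.
  move: mm'; rewrite /graph -e1 => /eq_in_map mm' i /mm'; by case.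
apply/eqP/cmP => i; have [/e2//|im] := boolP (i \in finsupp m).
have im' : i \notin finsupp m' by rewrite -[_ \in _]/(i \in enum_fset _) -e1.
by move: im im'; rewrite -!cmE_eq0 => /eqP-> /eqP->.
Qed.

(** Were all fibers finite, numbering the elements of each would embed T into
    U * nat. *)
Lemma infinite_fiber T U (G : T -> U) :
  ~ embeds T (U * nat) -> exists u, infinite_set [set t | G t = u].
Proof.
apply: contra_notP => /forallNP fin.
have /choice[h h_inj] u : exists h : T -> nat,
    {in [set t | G t = u] &, injective h}.
  by apply/countable_injP/finite_set_countable; apply: contra_notP (fin u).
exists (fun t => (G t, h (G t) t)) => t t' [Gtt'] htt'.
by apply: (h_inj (G t)); rewrite ?inE //= htt' Gtt'.
Qed.

Lemma embeds_nat_infinite T (A : set T) :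
  infinite_set A -> embeds nat (set_type A).
Proof.
move=> /infiniteP/card_leP[g].
exists (fun n => g (exist _ n (mem_set I) : [set: nat])) => n m gnm.
by have [] := inj (in_setT _) (in_setT _) gnm.
Qed.

Lemma embeds_card_le T U (A : set U) :
  embeds T (set_type A) -> ([set: T] #<= A)%card.
Proof.
move=> [g g_inj].
have : ([set val (g t) | t in [set: T]] #= [set: T])%card.
  by apply: inj_card_eq => t t' _ _ /val_inj/g_inj.
rewrite card_eq_le => /andP[_ /card_le_trans]; apply.
by apply: subset_card_le => _ [t _ <-]; apply: set_valP.
Qed.

(** * Substitution morphisms of polynomial algebras *)

Section MvSubst.
Variables (F : fieldType) (J : choiceType).

HB.instance Definition _ :=
  GRing.RMorphism.copy (@mvconst F J) (@malgC {cmonom J} F).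

Section Monom.
Variables (S : comNzRingType) (v : J -> S).

Definition monom_eval (m : {cmonom J}) : S := \prod_(j <- finsupp m) v j ^+ m j.

Lemma monom_evalEw (d : {fset J}) (m : {cmonom J}) : (finsupp m `<=` d)%fset ->
  monom_eval m = \prod_(j <- d) v j ^+ m j.
Proof.
move=> sub; rewrite /monom_eval (big_fset_incl _ sub) // => j _.
by rewrite -cmE_eq0 => /eqP->; rewrite expr0.
Qed.

Lemma monom_eval_mmorphism : mmorphism monom_eval.
Proof.
split=> [m1 m2|]; last by rewrite /monom_eval mdom1 big_seq_fset0.
rewrite (monom_evalEw (fsubsetUl (finsupp m1) (finsupp m2))).
rewrite (monom_evalEw (fsubsetUr (finsupp m1) (finsupp m2))).
rewrite /monom_eval mdomD -big_split; apply: eq_bigr => j _.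
by rewrite cmM exprD.
Qed.

HB.instance Definition _ :=
  isMultiplicative.Build {cmonom J} S monom_eval monom_eval_mmorphism.

End Monom.

Variable S : comNzRingType.
HB.instance Definition _ (phi : {rmorphism F -> S}) (v : J -> S) :=
  GRing.RMorphism.copy (mvsubst phi v) (mmap phi (monom_eval v)).

Lemma mvsubst_const (phi : {rmorphism F -> S}) (v : J -> S) c :
  mvsubst phi v (mvconst J c) = phi c.
Proof. exact: (@mmapC _ _ _ _ (monom_eval v)). Qed.

Lemma mvsubst_var (phi : {rmorphism F -> S}) (v : J -> S) j :
  mvsubst phi v (mvar F j) = v j.
Proof.
have -> : mvsubst phi v (mvar F j) = phi 1 * monom_eval v (ucm j).
  exact: mmapU.
by rewrite rmorph1 mul1r /monom_eval mdomU big_seq_fset1 cmUU.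
Qed.

End MvSubst.

HB.instance Definition _ (F : fieldType) (J : choiceType) (x : J -> F) :=
  GRing.RMorphism.copy (mveval x) (mvsubst idfun x).

Lemma mveval_const (F : fieldType) (J : choiceType) (x : J -> F) c :
  mveval x (mvconst J c) = c.
Proof. exact: (mvsubst_const idfun x c). Qed.

Lemma mveval_var (F : fieldType) (J : choiceType) (x : J -> F) j :
  mveval x (mvar F j) = x j.
Proof. exact: (mvsubst_var idfun x j). Qed.

Lemma rmorph_mvsubst (F : fieldType) (J : choiceType) (S S' : comNzRingType)
    (g : {rmorphism S -> S'}) (phi : F -> S) (v : J -> S) (f : mvpoly F J) :
  g (mvsubst phi v f) = mvsubst (g \o phi) (g \o v) f.
Proof.
rewrite /mvsubst /mmap rmorph_sum; apply: eq_bigr => m _.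
rewrite rmorphM rmorph_prod; congr (_ * _); apply: eq_bigr => j _.
exact: rmorphXn.
Qed.

Definition occurs (F : fieldType) (J : choiceType) (f : mvpoly F J) : seq J :=
  flatten [seq enum_fset (finsupp m) | m : {cmonom J} <- msupp f].

(** Only the values at the variables occurring in f matter; this is what
    allows passing from the variables of J to a subset of them. *)
Lemma eq_mvsubst (F : fieldType) (J : choiceType) (S : comNzRingType)
    (phi psi : F -> S) (v w : J -> S) (f : mvpoly F J) :
  phi =1 psi -> {in occurs f, v =1 w} -> mvsubst phi v f = mvsubst psi w f.
Proof.
move=> phipsi vw; rewrite /mvsubst /mmap.
apply: eq_big_seq => m fm; rewrite phipsi; congr (_ * _).
apply: eq_big_seq => j mj; rewrite vw //.
by apply/flattenP; exists (enum_fset (finsupp m)) => //; apply: map_f.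
Qed.

Lemma monomM (F : fieldType) (J : choiceType) (m n : {cmonom J}) :
  << m >> * << n >> = << mmul m n >> :> mvpoly F J.
Proof. by rewrite malgM_def fgmulUU mulr1. Qed.

Lemma mvar_exp (F : fieldType) (J : choiceType) (j : J) n :
  exists2 m : {cmonom J},
    mvar F j ^+ n = << m >> & forall i, m i = ((j == i) * n)%N.
Proof.
elim: n => [|n [m mE mi]]; first by exists mone => // i; rewrite cm1 muln0.
exists (mmul (ucm j) m); first by rewrite exprS mE; exact: monomM.
by move=> i; rewrite cmM cmU mi mulnS.
Qed.

Lemma monom_eval_mvar (F : fieldType) (J : choiceType) (m : {cmonom J}) :
  monom_eval (@mvar F J) m = << m >>.
Proof.
have [p pE pi] : exists2 p : {cmonom J},
    monom_eval (@mvar F J) m = << p >> &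
    forall i, p i = (\sum_(j <- finsupp m) (j == i) * m j)%N.
  rewrite /monom_eval; elim: (enum_fset _) => [|j s [p pE pi]].
    by exists mone => [|i]; rewrite big_nil // cm1.
  have [q qE qi] := mvar_exp F j (m j).
  exists (mmul q p) => [|i].
    rewrite big_cons.
    exact: (etrans (congr2 *%R qE pE) (monomM F q p)).
  by rewrite big_cons cmM qi pi.
rewrite pE; congr << _ >>; apply/eqP/cmP => i; rewrite pi.
have [im|im] := boolP (i \in finsupp m).
  rewrite (big_fsetD1 i) //= eqxx mul1n big1_fset ?addn0 // => j.
  by rewrite !inE => /andP[/negPf-> _] _.
move: (im); rewrite -cmE_eq0 => /eqP->; rewrite big1_seq // => j /= jm.
by case: eqP jm im => [->|_ _ _]; [move=> ->|].
Qed.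

Lemma mvsubst_id (F : fieldType) (J : choiceType) (f : mvpoly F J) :
  mvsubst (@mvconst F J) (@mvar F J) f = f.
Proof.
rewrite [RHS]monalgE /mvsubst /mmap; apply: eq_bigr => m _.
have -> : \prod_(j <- finsupp m) mvar F j ^+ m j = << m >>.
  by rewrite -[LHS]/(monom_eval (@mvar F J) m) monom_eval_mvar.
by rewrite /mvconst malgM_def fgmulUU mul1m mulr1.
Qed.

Lemma mvpoly_ind (F : fieldType) (K : choiceType) (P : mvpoly F K -> Prop) :
  (forall c, P (mvconst K c)) -> (forall k, P (mvar F k)) ->
  (forall g h, P g -> P h -> P (g + h)) ->
  (forall g h, P g -> P h -> P (g * h)) -> forall h, P h.
Proof.
move=> Pc Pv PD PM h; rewrite -[h]mvsubst_id /mvsubst /mmap.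
have P0 : P 0 by rewrite -(rmorph0 (@mvconst F K)); apply: Pc.
have P1 : P 1 by rewrite -(rmorph1 (@mvconst F K)); apply: Pc.
have PX k n : P (mvar F k ^+ n).
  elim: n => [|n IHn]; first exact: P1.
  by rewrite exprS; apply: PM; first exact: Pv.
elim/big_rec: _ => [|m g _ Pg]; first exact: P0.
apply: (PD); last exact: Pg.
apply: (PM); first exact: Pc.
elim/big_rec: _ => [|k g' _ Pg']; first exact: P1.
apply: (PM); last exact: Pg'.
exact: PX.
Qed.

(** * Prime ideals *)

Definition is_prime (R : comNzRingType) (q : set R) : Prop :=
  [/\ is_ideal q, ~ q 1 & forall a b, q (a * b) -> q a \/ q b].

Section Ideals.
Variable R : comNzRingType.
Implicit Types (q : set R) (a b x : R).

Lemma is_ideal0 q : is_ideal q -> q 0. Proof. by case. Qed.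
Lemma is_idealD q a b : is_ideal q -> q a -> q b -> q (a + b).
Proof. by case=> _ qD _; apply: qD. Qed.
Lemma is_idealMl q a b : is_ideal q -> q b -> q (a * b).
Proof. by case=> _ _ qM; apply: qM. Qed.
Lemma is_idealMr q a b : is_ideal q -> q a -> q (a * b).
Proof. by rewrite mulrC; apply: is_idealMl. Qed.
Lemma is_idealN q a : is_ideal q -> q a -> q (- a).
Proof. by rewrite -mulN1r; apply: is_idealMl. Qed.
Lemma is_idealB q a b : is_ideal q -> q a -> q b -> q (a - b).
Proof. by move=> qI qa qb; apply: is_idealD => //; apply: is_idealN. Qed.
Lemma is_ideal_sum q (T : Type) (s : seq T) (P : pred T) (G : T -> R) :
  is_ideal q -> (forall i, P i -> q (G i)) -> q (\sum_(i <- s | P i) G i).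
Proof.
move=> qI qG; elim/big_rec: _ => [|i x Pi qx]; first exact: is_ideal0.
by apply: is_idealD => //; apply: qG.
Qed.

Lemma is_ideal_congM q a a' b b' :
  is_ideal q -> q (a - a') -> q (b - b') -> q (a * b - a' * b').
Proof.
move=> qI qa qb.
have -> : a * b - a' * b' = a * (b - b') + (a - a') * b' by ring.
by apply: is_idealD => //; [apply: is_idealMl|apply: is_idealMr].
Qed.

Lemma prime_exp q a n : is_prime q -> q (a ^+ n) -> q a.
Proof.
by move=> [_ q1 qM]; elim: n => [//|n IHn]; rewrite exprS => /qM[].
Qed.

(** An ideal q maximal among those that contain u and avoid the powers of f.
    Adding any x outside q makes the ideal meet the powers of f: this is the
    last clause, and primality follows from it. *)
Lemma prime_avoiding (u : set R) f : is_ideal u -> ~ radical u f ->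
  exists q, [/\ is_prime q, u `<=` q, ~ q f
    & forall x, ~ q x -> exists n y, q (f ^+ n - y * x)].
Proof.
move=> uI uf.
pose good q := [/\ is_ideal q, u `<=` q & forall n, ~ q (f ^+ n)].
have u_good : good u.
  split=> // -[|n] ufn; last by apply: uf; exists n.+1.
  by apply: uf; exists 1%N => //; rewrite expr1 -[f]mulr1; apply: is_idealMl.
(* The empty set is admitted so that the empty chain has an upper bound. *)
have [C CP Ctot|q [qP qmax]] := @Zorn_bigcup _ (fun q => q = set0 \/ good q).
  pose C' := [set q | C q /\ q !=set0].
  have CC' : \bigcup_(q in C) q = \bigcup_(q in C') q.
    apply/seteqP; split=> [t [q Cq qt]|t [q [Cq _] qt]]; exists q => //.
    by split=> //; exists t.
  have C'P q : C' q -> good q by move=> [/CP [->|//] [t]].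
  have [[q0 C'q0]|C'0] := pselect (exists q, C' q); last first.
    left; rewrite CC'; apply/seteqP; split=> // t [q C'q _].
    by case: C'0; exists q.
  right; rewrite CC'; have [q0I uq0 _] := C'P _ C'q0; split.
  - split=> [|a b [q C'q qa] [q' C'q' qb]|h a [q C'q qa]].
    + by exists q0 => //; apply: is_ideal0.
    + have [qI _ _] := C'P _ C'q; have [q'I _ _] := C'P _ C'q'.
      case: (Ctot _ _ C'q.1 C'q'.1) => sub.
        by exists q' => //; apply: is_idealD => //; apply: sub.
      by exists q => //; apply: is_idealD => //; apply: sub.
    + by exists q => //; have [qI _ _] := C'P _ C'q; apply: is_idealMl.
  - by move=> a ua; exists q0 => //; apply: uq0.
  - by move=> n [q C'q]; have [_ _] := C'P _ C'q; apply.
have {qP}[qI uq qf] : good q.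
  case: qP => [q_eq0|//]; case: (qmax u); last by right.
  by rewrite q_eq0; split=> // /(_ 0); apply; apply: is_ideal0.
have qmax' x : ~ q x -> exists n y, q (f ^+ n - y * x).
  move=> qx; pose q' := [set a | exists y, q (a - y * x)].
  apply: contrapT => /forallNP nq; apply: (qmax q').
    split=> [a qa|sub]; first by exists 0; rewrite mul0r subr0.
    apply: qx; apply: sub; exists 1.
    by rewrite mul1r subrr; apply: is_ideal0.
  right; split.
  - split=> [|a b [y qa] [z qb]|h a [y qa]].
    + by exists 0; rewrite mul0r subr0; apply: is_ideal0.
    + exists (y + z); rewrite mulrDl opprD addrACA; exact: is_idealD.
    + by exists (h * y); rewrite -mulrA -mulrBr; apply: is_idealMl.
  - by move=> a ua; exists 0; rewrite mul0r subr0; apply: uq.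
  - by move=> n [y qy]; apply: (nq n); exists y.
exists q; split=> //; last by move/(qf 1%N).
split=> // [|a b qab]; first exact: (qf 0%N).
have [qa|/qmax'[n [y qy]]] := pselect (q a); first by left.
have [qb|/qmax'[m [z qz]]] := pselect (q b); first by right.
case: (qf (n + m)%N); rewrite exprD.
have -> : f ^+ n * f ^+ m =
    (f ^+ n - y * a) * f ^+ m + (y * a) * (f ^+ m - z * b) + y * z * (a * b).
  by rewrite mulrBl mulrBr addrA subrK [y * z * _]mulrACA subrK.
apply: is_idealD => //; last exact: is_idealMl.
by apply: is_idealD => //; [apply: is_idealMr|apply: is_idealMl].
Qed.

End Ideals.

Lemma is_ideal_zero (R : comNzRingType) : is_ideal [set a : R | a = 0].
Proof.
by split=> //= [a b -> ->|h a ->]; rewrite ?addr0 ?mulr0.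
Qed.

Lemma preimage_ideal (R S : comNzRingType)
    (g : {rmorphism R -> S}) (q : set S) :
  is_ideal q -> is_ideal [set a | q (g a)].
Proof.
move=> qI; split=> /= [|a b|h a]; first by rewrite rmorph0; apply: is_ideal0.
  by rewrite rmorphD; apply: is_idealD.
by rewrite rmorphM; apply: is_idealMl.
Qed.

Lemma preimage_prime (R S : comNzRingType)
    (g : {rmorphism R -> S}) (q : set S) :
  is_prime q -> is_prime [set a | q (g a)].
Proof.
move=> [qI q1 qM]; split=> /= [||a b]; first exact: preimage_ideal.
  by rewrite rmorph1.
by rewrite rmorphM; apply: qM.
Qed.

(** * Points on primes of finitely generated algebras *)

(** The Nullstellensatz for the F-algebra R, prime ideal by prime ideal: the
    elements that vanish at all F-points of a prime are those in the prime. *)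
Definition separates (F : fieldType) (R : comNzRingType)
    (iota : F -> R) : Prop :=
  forall (q : set R) (g : R), is_prime q -> ~ q g ->
  exists phi : {rmorphism R -> F},
    [/\ cancel iota phi, forall a, q a -> phi a = 0 & phi g != 0].

Lemma separates_field (F : fieldType) : separates (@idfun F).
Proof.
move=> q g [qI q1 _] qg; exists idfun; split=> // [a qa|].
  apply: contra_notP q1 => /eqP a0.
  by rewrite -(mulVf a0); apply: is_idealMl.
by apply: contra_notN qg => /eqP /= ->; apply: is_ideal0.
Qed.

Section PolyExtension.
Variables (F : closedFieldType) (R : idomainType) (q : set {poly R}).
Hypothesis qP : is_prime q.
Implicit Types (f g p r : {poly R}).

Let qI : is_ideal q. Proof. by case: qP. Qed.

Definition contraction : set R := [set a | q a%:P].

Definition coefs_in f := forall i, contraction f`_i.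

Lemma contraction_prime : is_prime contraction.
Proof. exact: (preimage_prime polyC qP). Qed.

Let cI : is_ideal contraction. Proof. by case: contraction_prime. Qed.

Lemma coefs_in_ideal f : coefs_in f -> q f.
Proof.
move=> qf; rewrite -[f]coefK poly_def; apply: is_ideal_sum => // i _.
by rewrite -mul_polyC; apply: is_idealMr => //; apply: qf.
Qed.

(** A leading term with coefficient in the contraction may be discarded
    modulo q; minimal polynomials therefore have leading coefficients outside
    the contraction. *)
Lemma drop_lead f : f != 0 -> contraction (lead_coef f) ->
  exists f', [/\ (size f' < size f)%N, q (f - f') & coefs_in f' -> coefs_in f].
Proof.
move=> f0 qlf; pose n := (size f).-1.
have sf : size f = n.+1 by rewrite prednK // size_poly_gt0.
have lE : lead_coef f = f`_n by [].
exists (f - (lead_coef f)%:P * 'X^n); split.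
- rewrite sf ltnS; apply/leq_sizeP => j; rewrite leq_eqVlt => /orP[/eqP<-|nj].
    by rewrite coefB coefCM coefXn eqxx mulr1 lE subrr.
  by rewrite coefB coefCM coefXn (gtn_eqF nj) mulr0 subr0 nth_default // sf.
- by rewrite opprB addrCA subrr addr0; apply: is_idealMr.
- move=> cf i; have := cf i; rewrite coefB coefCM coefXn => qi.
  rewrite -[f`_i](subrK (lead_coef f * (i == n)%:R)).
  by apply: is_idealD => //; apply: is_idealMr.
Qed.

Lemma min_size (P : {poly R} -> Prop) : (exists p, P p) ->
  exists2 p, P p & forall r, (size r < size p)%N -> ~ P r.
Proof.
move=> [p0 Pp0].
have ex : exists n, `[< exists2 p, P p & size p = n >].
  by exists (size p0); apply/asboolP; exists p0.
case: (ex_minnP ex) => n /asboolP[p Pp <-] min; exists p => // r ltrp Pr.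
have : (size p <= size r)%N by apply: min; apply/asboolP; exists r.
by rewrite leqNgt ltrp.
Qed.

(** If X is algebraic modulo q, a witness p of least degree plays the role of a
    minimal polynomial over the fraction field of the quotient of R by the
    contraction. *)
Lemma min_relation : ~ q `<=` coefs_in -> exists p,
  [/\ q p, (1 < size p)%N, ~ contraction (lead_coef p)
    & forall r, (size r < size p)%N -> q r -> coefs_in r].
Proof.
move=> /existsNP[p0 /not_implyP[qp0 cp0]].
have [|p [qp cp] pmin] := @min_size (fun p => q p /\ ~ coefs_in p).
  by exists p0.
have p_neq0 : p != 0.
  by apply: contra_notN cp => /eqP-> i; rewrite coef0; apply: is_ideal0.
have lp : ~ contraction (lead_coef p).
  move=> /(drop_lead p_neq0)[p' [ltp' qpp' cp']].
  apply: (pmin p' ltp'); split=> [|/cp'//].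
  by rewrite -[p'](subKr p); apply: is_idealB.
exists p; split=> // [|r ltr qr]; last first.
  by apply: contrapT => cr; case: (pmin r ltr).
rewrite ltnNge; apply/negP => /size1_polyC pE; apply: lp.
by rewrite pE lead_coefC /contraction /= -pE.
Qed.

Lemma scale_in (a : R) f : q f -> q (a *: f).
Proof. by rewrite -mul_polyC; apply: is_idealMl. Qed.

(** In the algebraic case g divides, modulo q, a constant outside the
    contraction.  Let f be a multiple of g modulo q of least degree outside q.
    Reducing f modulo p shows that its degree is below that of p.  If f were
    not constant, reducing p modulo f would give a factorization of p, up to a
    constant, whose cofactor lies in q and has degree below that of p; so all
    coefficients of p would be in the contraction. *)
Lemma elimination p g :
  q p -> (1 < size p)%N -> ~ contraction (lead_coef p) ->
  (forall r, (size r < size p)%N -> q r -> coefs_in r) -> ~ q g ->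
  exists c w, ~ contraction c /\ q (c%:P - w * g).
Proof.
move=> qp size_p lp pmin qg; have [_ q1 qM] := qP.
have [_ _ cM] := contraction_prime.
have lexp f k : ~ contraction (lead_coef f) -> ~ contraction (lead_coef f ^+ k).
  by move=> lf /(prime_exp contraction_prime).
have p0 : p != 0 by rewrite -size_poly_gt0 ltnW.
have [|f [qf [w qw]] fmin] :=
    @min_size (fun f => ~ q f /\ exists w, q (f - w * g)).
  by exists g; split=> //; exists 1; rewrite mul1r subrr; apply: is_ideal0.
have f0 : f != 0 by apply: contra_notN qf => /eqP->; apply: is_ideal0.
have lf : ~ contraction (lead_coef f).
  move=> /(drop_lead f0)[f' [ltf' qff' _]]; apply: (fmin f' ltf').
  split=> [qf'|]; first by apply: qf; rewrite -[f](subrK f'); apply: is_idealD.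
  exists w; have -> : f' - w * g = f - w * g - (f - f') by ring.
  exact: is_idealB.
have size_f : (size f < size p)%N.
  rewrite ltnNge; apply/negP => lepf.
  have rE := Pdiv.Idomain.divp_eq f p; set k := scalp f p in rE.
  apply: (fmin (f %% p)); first by apply: leq_trans lepf; rewrite ltn_modp.
  have -> : f %% p = lead_coef p ^+ k *: f - f %/ p * p.
    by rewrite rE addrC addKr.
  split=> [qr|].
    have : q (lead_coef p ^+ k *: f).
      rewrite -[_ *: f](subrK (f %/ p * p)).
      by apply: is_idealD => //; apply: is_idealMl.
    by rewrite -mul_polyC => /qM[/lexp-/(_ lp)|].
  exists ((lead_coef p ^+ k) *: w).
  rewrite addrAC -scalerAl -scalerBr.
  apply: is_idealB => //; first exact: scale_in.
  exact: is_idealMl.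
suff sf1 : (size f <= 1)%N.
  exists f`_0, w; rewrite -size1_polyC //; split=> // cf; apply: qf.
  by rewrite [f]size1_polyC.
rewrite leqNgt; apply/negP => sf1.
have rE := Pdiv.Idomain.divp_eq p f; set k := scalp p f in rE.
set Q := p %/ f in rE; set r := p %% f in rE.
have ltrf : (size r < size f)%N by rewrite ltn_modp.
have rE' : r = lead_coef f ^+ k *: p - Q * f by rewrite rE addrC addKr.
have qr : q r.
  apply: contrapT => qr; apply: (fmin r ltrf); split=> //.
  exists (- Q * w).
  have -> : r - - Q * w * g = lead_coef f ^+ k *: p - Q * (f - w * g).
    by rewrite rE'; ring.
  by apply: is_idealB => //; [apply: scale_in|apply: is_idealMl].
have cr : coefs_in r by apply: pmin => //; apply: ltn_trans size_f.
have qQf : q (Q * f).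
  have -> : Q * f = lead_coef f ^+ k *: p - r by rewrite rE' subKr.
  by apply: is_idealB => //; apply: scale_in.
have [qQ|//] := qM _ _ qQf.
have cQ : coefs_in Q.
  apply: pmin => //; rewrite size_divp // ltn_subrL.
  by rewrite -ltnS prednK ?sf1 ?(ltnW size_p) // ltnW.
have /cM[/lexp-/(_ lf)//|//] : contraction (lead_coef f ^+ k * lead_coef p).
rewrite lead_coefE -coefZ rE coefD; apply: is_idealD => //.
by rewrite coefM; apply: is_ideal_sum => // i _; apply: is_idealMr.
Qed.
End PolyExtension.

(** Extend a morphism phi given on R by sending X to some y.  In the
    transcendental case phi keeps one coefficient of g nonzero and y is a
    non-root of the image of g.  In the algebraic case phi keeps nonzero the
    leading coefficient of p and the constant provided by [elimination], and y
    is a root of the image of p. *)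
Lemma separates_poly (F : closedFieldType) (R : idomainType) (iota : F -> R) :
  separates iota -> separates (polyC \o iota).
Proof.
move=> sepR q g qP qg; have cP := contraction_prime qP.
have [_ _ cM] := cP; have [qI _ qM] := qP.
pose ext (phi : {rmorphism R -> F}) (y : F) : {rmorphism {poly R} -> F} :=
  horner_eval y \o map_poly phi.
have extC phi y c : ext phi y c%:P = phi c.
  by rewrite /= /horner_eval map_polyC hornerC.
have extE phi y f : ext phi y f = (map_poly phi f).[y] by [].
have ext_coefs (phi : {rmorphism R -> F}) y f :
    (forall a, contraction q a -> phi a = 0) -> coefs_in q f -> ext phi y f = 0.
  move=> phiq cf; rewrite extE; suff -> : map_poly phi f = 0 by rewrite horner0.
  by apply/polyP => i; rewrite coef_map coef0; apply: phiq.
have [sub|/(min_relation qP)[p [qp size_p lp pmin]]] :=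
  pselect (q `<=` coefs_in q).
  have [i gi] : exists i, ~ contraction q g`_i.
    by apply/existsNP => cg; apply: qg; apply: coefs_in_ideal.
  have [phi [phiK phiq phig]] := sepR _ _ cP gi.
  have /closed_nonrootP[y gy] : map_poly phi g != 0.
    by apply: contraNneq phig => g0; rewrite -coef_map g0 coef0.
  exists (ext phi y); split=> [c|a qa|]; last exact: gy.
    by rewrite extC phiK.
  by apply: ext_coefs => //; apply: sub.
have [c [w [qc qcw]]] := elimination qP qp size_p lp pmin qg.
have lpc : ~ contraction q (lead_coef p * c) by move=> /cM[].
have [phi [phiK phiq]] := sepR _ _ cP lpc.
rewrite rmorphM mulf_eq0 negb_or => /andP[phip phic].
have /closed_rootP[y py] : size (map_poly phi p) != 1%N.
  by rewrite size_map_poly_id0 // gtn_eqF.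
have ext0 f : q f -> ext phi y f = 0.
  move=> qf; have p0 : p != 0 by rewrite -size_poly_gt0 ltnW.
  have rE := Pdiv.Idomain.divp_eq f p.
  have r0 : ext phi y (f %% p) = 0.
    apply: ext_coefs => //; apply: pmin; first by rewrite ltn_modp.
    have -> : f %% p = lead_coef p ^+ scalp f p *: f - f %/ p * p.
      by rewrite rE addrC addKr.
    by apply: is_idealB => //; [apply: scale_in|apply: is_idealMl].
  have := congr1 (ext phi y) rE.
  rewrite rmorphD rmorphM r0 addr0 [X in _ * X]extE (rootP py) mulr0.
  rewrite -mul_polyC rmorphM extC rmorphXn => /eqP.
  by rewrite mulf_eq0 expf_eq0 (negPf phip) andbF => /eqP.
exists (ext phi y); split=> [d|//|]; first by rewrite extC phiK.
apply: contraNneq phic => g0; rewrite -(extC phi y c).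
by rewrite -[c%:P](subrK (w * g)) rmorphD ext0 // rmorphM g0 mulr0 addr0.
Qed.

(** Iterated polynomial rings over F satisfy the Nullstellensatz and map onto
    any finitely generated algebra. *)
Lemma finite_generation_model (F : closedFieldType) (C : comNzRingType)
    (j : {rmorphism F -> C}) (s : seq C) :
  exists (R : idomainType) (iota : {rmorphism F -> R})
    (pi : {rmorphism R -> C}),
  [/\ separates iota, pi \o iota =1 j & {in s, forall x, exists y, pi y = x}].
Proof.
elim: s => [|x s [R [iota [pi [sepR piK lift]]]]].
  by exists F, idfun, j; split=> //; apply: separates_field.
exists {poly R}, (polyC \o iota), (horner_eval x \o map_poly pi).
split=> [|c|z]; first exact: separates_poly.
  by rewrite /= /horner_eval map_polyC hornerC; apply: piK.
rewrite inE => /orP[/eqP->|/lift[y <-]].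
  by exists 'X; rewrite /= /horner_eval map_polyX hornerX.
by exists y%:P; rewrite /= /horner_eval map_polyC hornerC.
Qed.

Definition separating_point (F : fieldType) (K : choiceType)
    (q : set (mvpoly F K)) (f : mvpoly F K) : Prop :=
  exists2 c : K -> F, (forall h, q h -> mveval c h = 0) & mveval c f != 0.

(** A model R of the polynomial algebra comes with a section sigma of its
    projection pi, so a morphism from R to F that kills the preimage of q is
    evaluation at the images of the lifted variables. *)
Lemma finite_separating_point (F : closedFieldType) (K : choiceType) (s : seq K)
    (q : set (mvpoly F K)) (f : mvpoly F K) :
  (forall k, k \in s) -> is_prime q -> ~ q f -> separating_point q f.
Proof.
move=> sK qP qf.
have [R [iota [pi [sepR piK lift]]]] :=
  finite_generation_model (@mvconst F K) (map (@mvar F K) s).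
have /choice[y yP] (k : K) : exists y, pi y = mvar F k.
  by apply/lift/map_f.
pose sigma h : R := mvsubst iota y h.
have sigmaK h : pi (sigma h) = h.
  rewrite rmorph_mvsubst -[RHS]mvsubst_id.
  by apply: eq_mvsubst => [c|k _]; [apply: piK|apply: yP].
have [phi [phiK phiq phif]] : exists phi : {rmorphism R -> F},
    [/\ cancel iota phi, forall a, q (pi a) -> phi a = 0 & phi (sigma f) != 0].
  apply: (sepR [set a | q (pi a)]); first exact: preimage_prime.
  by rewrite /= sigmaK.
have evE h : mveval (phi \o y) h = phi (sigma h).
  by rewrite rmorph_mvsubst; apply: eq_mvsubst => [c|//]; rewrite /= phiK.
exists (phi \o y) => [h qh|]; rewrite evE //.
by apply: phiq; rewrite sigmaK.
Qed.

(** * Points on primes in few variables *)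

Lemma prime_root (F : closedFieldType) (R : comNzRingType)
    (iota : {rmorphism F -> R}) (q : set R) (x : R) (p : {poly F}) :
  is_prime q -> p != 0 -> q (map_poly iota p).[x] ->
  exists c, q (x - iota c).
Proof.
move=> [qI q1 qM] p0; have [r ->] := closed_field_poly_normal p.
rewrite map_polyZ hornerZ => /qM[qlead|].
  case: q1; rewrite -(rmorph1 iota) -(@mulVf _ (lead_coef p)) ?lead_coef_eq0 //.
  by rewrite rmorphM; apply: is_idealMl.
rewrite rmorph_prod horner_prod.
elim: r => [|c r IHr]; first by rewrite big_nil.
rewrite big_cons => /qM[|/IHr//].
by rewrite rmorphB /= map_polyX map_polyC hornerXsubC; exists c.
Qed.

(** The y c stand for g / (x - c) modulo q.  Multiplying a linear relation
    between them by the product of all the x - d turns it into p(x) in q, where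
    p is the sum of the l c times the product of the X - d for d <> c.  This p
    is nonzero, since its value at c0 is the product of l c0 and of the
    differences c0 - d. *)
Lemma resolvent_relation (F : closedFieldType) (R : comNzRingType)
    (iota : {rmorphism F -> R}) (q : set R) (x g : R) (s : seq F)
    (y : F -> R) (l : F -> F) :
  is_prime q -> ~ q g -> uniq s ->
  {in s, forall c, q (g - y c * (x - iota c))} ->
  \sum_(c <- s) iota (l c) * y c = 0 ->
  (exists2 c, c \in s & l c != 0) ->
  exists c, q (x - iota c).
Proof.
move=> qP qg s_uniq qy rel [c0 sc0 lc0]; have [qI q1 qM] := qP.
pose pi c : {poly F} := \prod_(d <- s | d != c) ('X - d%:P).
pose p : {poly F} := \sum_(c <- s) l c *: pi c.
apply: (@prime_root _ _ iota q x p) => //.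
  have pi0 c : c \in s -> c != c0 -> (pi c).[c0] = 0.
    move=> sc cc0; rewrite horner_prod (big_rem c0) //= eq_sym cc0.
    by rewrite hornerXsubC subrr mul0r.
  apply: contra_neq lc0 => p0; have : p.[c0] = 0 by rewrite p0 horner0.
  rewrite horner_sum (bigD1_seq c0) //=.
  rewrite big1_seq => [|c /andP[cc0 sc]]; last first.
    by rewrite hornerZ pi0 // mulr0.
  rewrite addr0 hornerZ => /eqP; rewrite mulf_eq0 => /orP[/eqP//|].
  rewrite horner_prod prodf_seq_eq0 => /hasP[d sd] /andP[dc0].
  by rewrite hornerXsubC subr_eq0 eq_sym (negPf dc0).
suff /qM[] : q (g * (map_poly iota p).[x]) by [].
pose ev c : R := (map_poly iota (pi c)).[x].
have evE : (map_poly iota p).[x] = \sum_(c <- s) iota (l c) * ev c.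
  rewrite rmorph_sum horner_sum; apply: eq_bigr => c _.
  by rewrite /= map_polyZ hornerZ.
pose e : R := \prod_(d <- s) (x - iota d).
have ev_mul c : c \in s -> (x - iota c) * ev c = e.
  move=> sc; rewrite /e (bigD1_seq c) //=; congr (_ * _).
  rewrite /ev /pi rmorph_prod horner_prod; apply: eq_bigr => d _.
  by rewrite rmorphB /= map_polyX map_polyC hornerXsubC.
have -> : g * (map_poly iota p).[x] =
    \sum_(c <- s) iota (l c) * ev c * (g - y c * (x - iota c)).
  transitivity (\sum_(c <- s) iota (l c) * ev c * g -
                e * \sum_(c <- s) iota (l c) * y c).
    by rewrite rel mulr0 subr0 -mulr_suml -evE mulrC.
  rewrite mulr_sumr -sumrB; apply: eq_big_seq => c sc.
  rewrite mulrBr -(ev_mul c sc); congr (_ - _).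
  by ring.
rewrite big_seq; apply: is_ideal_sum => // c sc.
by apply: is_idealMl => //; apply: qy.
Qed.

(** The coefficients of the y c on S form a matrix with more rows than columns,
    so its left kernel is nonzero. *)
Lemma linear_relation (F : fieldType) (K : choiceType) (s : seq F)
    (S : {fset {cmonom K}}) (y : F -> mvpoly F K) :
  uniq s -> (size (enum_fset S) < size s)%N ->
  {in s, forall c, msupp (y c) = S} ->
  exists2 l : F -> F, exists2 c, c \in s & l c != 0
    & \sum_(c <- s) mvconst K (l c) * y c = 0.
Proof.
move=> s_uniq ltSs yS.
set n := size s in ltSs; set m := size (enum_fset S) in ltSs.
pose M : 'M[F]_(n, m) :=
  \matrix_(i, j) (y (nth 0 s i))@_(nth mone (enum_fset S) j).
have : kermx M != 0.
  rewrite -mxrank_eq0 mxrank_ker subn_eq0 -ltnNge.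
  exact: leq_ltn_trans (rank_leq_col M) ltSs.
move=> /rowV0Pn[v /sub_kermxP vM v0].
pose l c := if insub (index c s) is Some i then v 0 i else 0.
have lE (i : 'I_n) : l (nth 0 s i) = v 0 i.
  by rewrite /l index_uniq // valK.
have [i vi] : exists i, v 0 i != 0 by apply/rV0Pn.
exists l; first by exists (nth 0 s i); rewrite ?lE // mem_nth.
apply/malgP => k; rewrite raddf_sum mcoeff0.
have [kS|kS] := boolP (k \in S); last first.
  rewrite big1_seq // => c /= sc.
  have yck : (y c)@_k = 0 by apply/mcoeff_outdom; rewrite yS.
  by have := mcoeffCM (l c) (y c) k; rewrite yck mulr0.
have kS' : (index k (enum_fset S) < m)%N by rewrite index_mem.
have := congr1 (fun N : 'rV_m => N 0 (Ordinal kS')) vM; rewrite !mxE => vMk.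
rewrite -[RHS]vMk.
rewrite (big_nth 0) big_mkord; apply: eq_bigr => d _.
by rewrite mxE /= nth_index // -lE; apply: mcoeffCM.
Qed.

(** Every variable is congruent to a constant c k modulo q, so every h is
    congruent to h(c); thus h(c) = 0 exactly when h lies in q. *)
Lemma infinite_separating_point (F : closedFieldType) (K : choiceType)
    (q : set (mvpoly F K)) (f : mvpoly F K) :
  embeds nat K -> ~ embeds F K -> is_prime q -> ~ q f ->
  (forall x, ~ q x -> exists n y, q (f ^+ n - y * x)) ->
  separating_point q f.
Proof.
move=> nK FK qP qf qmax; have [qI q1 qM] := qP.
have /choice[c cP] (k : K) : exists c, q (mvar F k - mvconst K c).
  apply: contrapT => /forallNP nc.
  have /choice[ny nyP] (c : F) : exists ny : nat * mvpoly F K,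
      q (f ^+ ny.1 - ny.2 * (mvar F k - mvconst K c)).
    by have [n [y qny]] := qmax _ (nc c); exists (n, y).
  have [|[n S] fib] := @infinite_fiber F (nat * {fset {cmonom K}})
    (fun c => ((ny c).1, msupp (ny c).2)).
    apply: contra_not FK => /embeds_trans; apply.
    have cK : embeds {fset {cmonom K}} K.
      by apply: embeds_fset => //; apply: embeds_cmonom => //; exists id.
    by apply: embeds_prod => //; apply: embeds_prod.
  have [B Bfib ltB] := infinite_set_fset (size (enum_fset S)).+1 fib.
  have BP b : b \in enum_fset B -> (ny b).1 = n /\ msupp (ny b).2 = S.
    by move=> /Bfib[].
  have [|//|b /BP[]//|l l0 rel] :=
    @linear_relation F K (enum_fset B) S (fun c => (ny c).2).
    exact: fset_uniq.
  case: (@resolvent_relation F _ (@mvconst F K) q (mvar F k) (f ^+ n)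
           (enum_fset B) (fun c => (ny c).2) l) => //.
  - by move/(prime_exp qP).
  - exact: fset_uniq.
  - by move=> b bB; have := nyP b; rewrite (BP b bB).1.
have qev h : q (h - mvconst K (mveval c h)).
  apply: (@mvpoly_ind _ _ (fun h => q (h - mvconst K (mveval c h)))) h =>
    [a|k|g h qg qh|g h qg qh].
  - by rewrite mveval_const subrr; apply: is_ideal0.
  - by rewrite mveval_var.
  - rewrite (rmorphD (mveval c)) (rmorphD (@mvconst F K)) opprD addrACA.
    exact: (is_idealD qI qg qh).
  - rewrite (rmorphM (mveval c)) (rmorphM (@mvconst F K)).
    exact: (is_ideal_congM qI qg qh).
exists c => [h qh|]; last first.
  by apply: contra_notN qf => /eqP f0; have := qev f; rewrite f0 rmorph0 subr0.
apply: contra_notP q1 => /eqP h0.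
rewrite -(rmorph1 (@mvconst F K)) -(mulVf h0) rmorphM; apply: is_idealMl => //.
have := is_idealB qI qh (qev h); rewrite subKr; exact.
Qed.

(** * Reduction to the variables of I and of f *)

Section Restriction.
Variables (F : closedFieldType) (J : choiceType) (I : set J).
Variables (u : set (mvpoly F J)) (f : mvpoly F J).

Let K := {j : J | `[< I j >] || (j \in occurs f)}.

Let rho : mvpoly F K -> mvpoly F J :=
  mvsubst (@mvconst F J) (fun k : K => mvar F (val k)).

Let incl (i : set_type I) : K.
Proof.
exists (val i); apply/orP; left; apply/asboolP; exact: set_valP.
Defined.

(* The value 0 is never used: K contains every variable occurring in f. *)
Let restr : mvpoly F K :=
  mvsubst (@mvconst F K) (fun j => if insub j is Some k then mvar F k else 0) f.

Lemma rho_restr : rho restr = f.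
Proof.
rewrite -[RHS]mvsubst_id /rho /restr rmorph_mvsubst.
apply: eq_mvsubst => [c|j fj /=]; first exact: mvsubst_const.
by rewrite insubT ?fj ?orbT // => jK; rewrite mvsubst_var.
Qed.

(** Extending a point of F^K by 0 does not affect the polynomials that come
    from K. *)
Lemma mveval_rho (c : K -> F) h :
  mveval c h = mveval (fun j => if insub j is Some k then c k else 0) (rho h).
Proof.
rewrite /rho rmorph_mvsubst; apply: eq_mvsubst => [a|k _] /=.
  by rewrite mveval_const.
by rewrite mveval_var valK.
Qed.

Lemma rho_incl (a : mvpoly F (set_type I)) :
  rho (mvsubst (@mvconst F K) (fun i => mvar F (incl i)) a) = mvincl a.
Proof.
rewrite /rho rmorph_mvsubst; apply: eq_mvsubst => [c|i _] /=.
  exact: mvsubst_const.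
exact: mvsubst_var.
Qed.

Lemma embeds_restr_index : embeds K (set_type I + nat).
Proof.
exists (fun k => if pselect (I (val k)) is left Ik
                 then inl (exist _ (val k) (mem_set Ik) : set_type I)
                 else inr (index (val k) (occurs f))).
move=> k k'; case: pselect => Ik; case: pselect => Ik' //= [] kk'.
  exact: val_inj.
have occ (l : K) : ~ I (val l) -> val l \in occurs f.
  by case/orP: (valP l) => // /asboolP.
apply: val_inj.
by rewrite -(nth_index (val k) (occ k Ik)) kk' nth_index ?occ.
Qed.

Lemma finite_restr_index : finite_set I -> exists s : seq K, forall k, k \in s.
Proof.
move=> /finite_fsetP[A IA]; exists (pmap insub (enum_fset A ++ occurs f)) => k.
rewrite mem_pmap_sub mem_cat; case/orP: (valP k) => [/asboolP Ik|->].
  have sIA : I `<=` [set` A] by rewrite -IA.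
  by have /= -> := sIA _ Ik.
by rewrite orbT.
Qed.

Lemma vanishing_in_radical (a : set (mvpoly F (set_type I))) :
  ~ embeds F (set_type I) -> is_ideal u -> u = ideal_ext a ->
  vanishing_ideal (zero_set u) f -> radical u f.
Proof.
move=> FI uI ua uf; apply: contrapT => urf.
have rI : is_ideal [set h | u (rho h)] by apply: preimage_ideal.
have [|q [qP rq qf qmax]] := @prime_avoiding _ _ restr rI.
  move=> [n n0] /=.
  have -> : rho (restr ^+ n) = rho restr ^+ n by exact: rmorphXn.
  by rewrite rho_restr => un; apply: urf; exists n.
have [c cq cf] : separating_point q restr.
  have [Ifin|Iinf] := pselect (finite_set I).
    have [s sK] := finite_restr_index Ifin.
    exact: finite_separating_point sK _ _.
  have nI : embeds nat (set_type I).
    by apply: embeds_nat_infinite.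
  have KI : embeds K (set_type I).
    exact: embeds_trans embeds_restr_index (embeds_sum_nat nI).
  apply: infinite_separating_point => //.
    apply: embeds_trans nI _; exists incl => i i' ii'.
    exact/val_inj/(congr1 val ii').
  by move=> /embeds_trans/(_ KI).
pose x j := if insub j is Some k then c k else 0 : F.
have xu : zero_set u x.
  suff sub : u `<=` [set h | mveval x h = 0] by move=> h uh; exact: sub.
  rewrite ua; apply: smallest_sub => [|_ [g ag <-]].
    exact: (preimage_ideal (mveval x) (@is_ideal_zero F)).
  rewrite /= -rho_incl -mveval_rho; apply: cq; apply: rq.
  by rewrite /= rho_incl ua; apply: sub_gen_smallest; exists g.
by move/eqP: cf; apply; rewrite mveval_rho rho_restr; apply: uf.
Qed.

End Restriction.

Theorem corollary1p5 (F : closedFieldType) (J : choiceType) (I : set J)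
    (u : set (mvpoly F J)) :
  I !=set0 ->
  card_lt I [set: F] ->
  is_ideal u ->
  (exists a : set (mvpoly F (set_type I)), is_ideal a /\ u = ideal_ext a) ->
  vanishing_ideal (zero_set u) = radical u.
Proof.
move=> _ [leIF neIF] uI [a [_ ua]]; apply/seteqP; split=> f.
  apply: vanishing_in_radical ua => //; apply: contra_not neIF => FI.
  by rewrite card_eq_le leIF; apply: embeds_card_le.
move=> [n n0 ufn] x xu; have := xu _ ufn.
have -> : mveval x (f ^+ n) = mveval x f ^+ n by exact: rmorphXn.
by move/eqP; rewrite expf_eq0 n0 => /eqP.
Qed.
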